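(* Assume $\mathcal Y\neq\emptyset$, $A$ has full row rank $m$, $Z^TQZ\succ 0$, the quadratic program has an optimal solution $y^*$ with multipliers $\lambda^*$ for the bound constraints, and the matrix $[R\;\;E^*]$ has full column rank. Let $\{(y^k,w^k,\lambda^k)\}$ be generated by the ADMM iteration. Then for every $k$ such that $\mathcal A^k\nsubseteq\mathcal A^*$, $$\|v^{k+1}-v^*\|\le \delta(\|M_Z\|,c_F^k,\alpha^{\max}(\Delta^k))\,\|v^k-v^*\|,$$ with convergence rate $\delta(\|M_Z\|,c_F^k,\alpha^{\max}(\Delta^k))<1$, where $\Delta^k=\|v^k-v^*\|$ and $c_F^k\le1$.
   Context: Problem. Let $Q\in\mathbb R^{n\times n}$ be symmetric positive semidefinite, $q\in\mathbb R^n$, $A\in\mathbb R^{m\times n}$, $b\in\mathbb R^m$, and $\mathcal Y=\{y\in\mathbb R^n:\underline y_i\le y_i\le\overline y_i\ \forall i\}$ with $-\infty\le\underline y_i<\overline y_i\le\infty$. The quadratic program (QP) is: minimize $q^Ty+\frac12 y^TQy$ subject to $Ay=b$, $y\in\mathcal Y$. Norms are Euclidean norms of vectors and spectral norms of matrices (the norm of a matrix with no columns is $0$). Notation. $\lambda\perp x\in\mathcal Y$ means $x\in\mathcal Y$ and $\lambda^T(x'-x)\ge0$ for all $x'\in\mathcal Y$. $R\in\mathbb R^{n\times m}$ and $Z\in\mathbb R^{n\times(n-m)}$ have columns forming orthonormal bases of the range of $A^T$ and of the null space of $A$. $\mathbb P_{\mathcal Y}$ is Euclidean projection onto $\mathcal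 Y$. Fix $\beta>0$, put $\tilde q=q/\beta$ and $$M=Z\big(Z^T(Q/\beta+I_n)Z\big)^{-1}Z^T,\quad N=(I_n-MQ/\beta)R(AR)^{-1},\quad M_Z=2(Z^TQZ/\beta+I_{n-m})^{-1}-I_{n-m}.$$ ADMM iteration, from arbitrary $w^0,\lambda^0\in\mathbb R^n$, for $k\ge0$: $y^{k+1}=M(w^k+\lambda^k-\tilde q)+Nb$, $w^{k+1}=\mathbb P_{\mathcal Y}(y^{k+1}-\lambda^k)$, $\lambda^{k+1}=\lambda^k+w^{k+1}-y^{k+1}$. Put $v^k=y^{k+1}-\lambda^k$ for $k\ge 0$. Solution. $y^*$ is an optimal solution with multipliers $\lambda^*\in\mathbb R^n$ for the bound constraints if for some $\xi^*\in\mathbb R^m$: $Qy^*+A^T\xi^*-\lambda^*=-q$, $Ay^*=b$, $\lambda^*\perp y^*\in\mathcal Y$. Put $v^*=y^*-\lambda^*/\beta$. $\mathcal A^*=\{i: y_i^*=\underline y_i\text{ or }y_i^*=\overline y_i\}$; $E^*$ is the matrix whose columns are the unit vectors $e_i$, $i\in\mathcal A^*$. Iteration quantities. $\mathcal A^k=\{i:\lambda_i^{k+1}\ne\lambda_i^*/\beta\}$; $E^k$ is the matrix whose columns are the unit vectors $e_i$, $i\in\mathcal A^k$; $c_F^k=\|R^TE^k\|$. The function $\alpha^{\max}$. Put $\Delta y_i^*=\min(y_i^*-\underline y_i,\overline y_i-y_i^* )$ and $\Delta y^*_{\min}=\min_{i\notin\mathcal A^*}\Delta y_i^*$ (this is finite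 whenever $\mathcal A^k\nsubseteq\mathcal A^*$ for some $k$). Then $\alpha^{\max}(\Delta)=\sqrt{1-(\Delta y^*_{\min}/\Delta)^2}$. Contraction factor. For $\kappa\ge 0$, $c\in[0,1]$, $\alpha^{\max}\in[0,1]$, $\delta(\kappa,c,\alpha^{\max})\ge0$ is defined by $$\delta(\kappa,c,\alpha^{\max})^2=\sup_{\zeta_u,\zeta_v,\alpha,\gamma}\ \tfrac14\big((\kappa\zeta_u+\zeta_v)^2+\gamma^2\big)$$ subject to $(\zeta_u+\zeta_v)^2\ge4(1-c^2)\alpha^2$, $\gamma^2\le4c^2\alpha^2$, $\gamma^2\le\big(\sqrt{1-\zeta_u^2}+\sqrt{1-\zeta_v^2}\big)^2$, $0\le\zeta_u,\zeta_v\le1$, $0\le\alpha\le\alpha^{\max}$. *)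

(* Defs.v *)
From mathcomp Require Export all_boot all_order all_algebra.
From mathcomp Require Export boolp classical_sets reals constructive_ereal ereal.

Set Implicit Arguments.
Unset Strict Implicit.
Unset Printing Implicit Defensive.

Import Order.TTheory GRing.Theory Num.Theory.
Local Open Scope classical_set_scope.
Local Open Scope ring_scope.

Section Defs.
Variable K : realType.

Definition vdot n (x y : 'cV[K]_n) : K := (x^T *m y) 0 0.

(* the library norm on matrices is the sup norm, hence this definition *)
Definition l2norm n (x : 'cV[K]_n) : K := Num.sqrt (vdot x x).

(* as the unit ball contains 0, this is 0 for a matrix with no columns *)
Definition spectral_norm p n (B : 'M[K]_(p, n)) : K :=
  sup [set l2norm (B *m x) | x in [set x : 'cV[K]_n | l2norm x <= 1]].

Definition psd n (B : 'M[K]_n) : Prop :=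
  B^T = B /\ forall x : 'cV[K]_n, 0 <= vdot x (B *m x).

Definition pd n (B : 'M[K]_n) : Prop :=
  B^T = B /\ forall x : 'cV[K]_n, x != 0 -> 0 < vdot x (B *m x).

(* the columns of B form an orthonormal basis of the space spanned by the
   (transposed) rows of V: the range of A^T for V = A, and the null space of A
   for V = kermx A^T *)
Definition orthonormal_basis p k n (B : 'M[K]_(n, p)) (V : 'M[K]_(k, n)) : Prop :=
  B^T *m B = 1%:M /\ (B^T == V)%MS.

(* the matrix whose columns are the unit vectors e_i, i \in S *)
Definition unit_columns n (S : {set 'I_n}) : 'M[K]_(n, #|S|) :=
  \matrix_(i, j) (i == enum_val j)%:R.

Definition box n (l u : 'I_n -> \bar K) : set 'cV[K]_n :=
  [set y | forall i, (l i <= (y i 0)%:E <= u i)%E].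

(* lam \perp x \in Y *)
Definition perp_in n (Y : set 'cV[K]_n) (lam x : 'cV[K]_n) : Prop :=
  Y x /\ forall x', Y x' -> 0 <= vdot lam (x' - x).

(* Euclidean projection; the default value 0 is irrelevant when Y is
   nonempty, closed and convex *)
Definition proj n (Y : set 'cV[K]_n) (x : 'cV[K]_n) : 'cV[K]_n :=
  xget 0 [set p | Y p /\ forall y, Y y -> l2norm (x - p) <= l2norm (x - y)].

Definition optimal_with_multipliers m n (Q : 'M[K]_n) (q : 'cV[K]_n)
    (A : 'M[K]_(m, n)) (b : 'cV[K]_m) (l u : 'I_n -> \bar K)
    (ystar lamstar : 'cV[K]_n) : Prop :=
  exists xi : 'cV[K]_m,
    [/\ Q *m ystar + A^T *m xi - lamstar = - q,
        A *m ystar = b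
      & perp_in (box l u) lamstar ystar].

Definition Mmat n p (Q : 'M[K]_n) (beta : K) (Z : 'M[K]_(n, p)) : 'M[K]_n :=
  Z *m invmx (Z^T *m (beta^-1 *: Q + 1%:M) *m Z) *m Z^T.

Definition Nmat m n p (Q : 'M[K]_n) (beta : K) (A : 'M[K]_(m, n))
    (R : 'M[K]_(n, m)) (Z : 'M[K]_(n, p)) : 'M[K]_(n, m) :=
  (1%:M - Mmat Q beta Z *m (beta^-1 *: Q)) *m R *m invmx (A *m R).

Definition MZmat n p (Q : 'M[K]_n) (beta : K) (Z : 'M[K]_(n, p)) : 'M[K]_p :=
  2%:R *: invmx (beta^-1 *: (Z^T *m Q *m Z) + 1%:M) - 1%:M.

(* y 0 is unconstrained and unused; w 0 and lam 0 are arbitrary *)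
Definition admm m n p (Q : 'M[K]_n) (q : 'cV[K]_n) (A : 'M[K]_(m, n))
    (b : 'cV[K]_m) (l u : 'I_n -> \bar K) (R : 'M[K]_(n, m)) (Z : 'M[K]_(n, p))
    (beta : K) (y w lam : nat -> 'cV[K]_n) : Prop :=
  forall k,
    [/\ y k.+1 = Mmat Q beta Z *m (w k + lam k - beta^-1 *: q)
                 + Nmat Q beta A R Z *m b,
        w k.+1 = proj (box l u) (y k.+1 - lam k)
      & lam k.+1 = lam k + w k.+1 - y k.+1].

Definition vseq n (y lam : nat -> 'cV[K]_n) (k : nat) : 'cV[K]_n :=
  y k.+1 - lam k.

Definition vstar n (beta : K) (ystar lamstar : 'cV[K]_n) : 'cV[K]_n :=
  ystar - beta^-1 *: lamstar.

Definition active_star n (l u : 'I_n -> \bar K) (ystar : 'cV[K]_n) : {set 'I_n} :=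
  [set i | ((ystar i 0)%:E == l i) || ((ystar i 0)%:E == u i)].

Definition active_iter n (beta : K) (lamstar : 'cV[K]_n)
    (lam : nat -> 'cV[K]_n) (k : nat) : {set 'I_n} :=
  [set i | lam k.+1 i 0 != lamstar i 0 / beta].

Definition cF m n (R : 'M[K]_(n, m)) (beta : K) (lamstar : 'cV[K]_n)
    (lam : nat -> 'cV[K]_n) (k : nat) : K :=
  spectral_norm (R^T *m unit_columns (active_iter beta lamstar lam k)).

Definition dy_star n (l u : 'I_n -> \bar K) (ystar : 'cV[K]_n) (i : 'I_n) : \bar K :=
  Order.min ((ystar i 0)%:E - l i)%E (u i - (ystar i 0)%:E)%E.

(* +oo when every i is active or no inactive i has a finite bound *)
Definition dy_star_min n (l u : 'I_n -> \bar K) (ystar : 'cV[K]_n) : \bar K :=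
  \big[Order.min/+oo%E]_(i | i \notin active_star l u ystar) dy_star l u ystar i.

(* meaningful only when Delta > 0 and dy_star_min is finite and at most Delta;
   this holds for Delta = l2norm (vseq y lam k - vstar beta ystar lamstar) as
   soon as active_iter at k is not included in active_star *)
Definition alpha_max n (l u : 'I_n -> \bar K) (ystar : 'cV[K]_n) (Delta : K) : K :=
  Num.sqrt (1 - (fine (dy_star_min l u ystar) / Delta) ^+ 2).

Definition delta_feasible (c amax zu zv a g : K) : Prop :=
  [/\ (zu + zv) ^+ 2 >= 4%:R * (1 - c ^+ 2) * a ^+ 2,
      g ^+ 2 <= 4%:R * c ^+ 2 * a ^+ 2,
      g ^+ 2 <= (Num.sqrt (1 - zu ^+ 2) + Num.sqrt (1 - zv ^+ 2)) ^+ 2,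
      0 <= zu <= 1 /\ 0 <= zv <= 1
    & 0 <= a <= amax].

Definition delta (kappa c amax : K) : K :=
  Num.sqrt (sup [set t | exists zu zv a g : K, delta_feasible c amax zu zv a g /\
                   t = 4%:R^-1 * ((kappa * zu + zv) ^+ 2 + g ^+ 2)]).

End Defs.

(* Main.v *)
Require Import Defs.
From mathcomp Require Import ring lra.

Set Implicit Arguments.
Unset Strict Implicit.
Unset Printing Implicit Defensive.

Import Order.TTheory GRing.Theory Num.Theory.
Local Open Scope classical_set_scope.
Local Open Scope ring_scope.

(** Put u = v^k - v^*, p = P_Y(v^k) - y^*, mu = lambda^(k+1) - lambda^*/beta
    = p - u and r = 2 p - u. Then v^(k+1) - v^* = M r + u - p
    = (Z (M_Z Z^T r + Z^T u) + R R^T (u - r)) / 2, whose two summands are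
    orthogonal. With D = |u|, the values zeta_u = |Z^T r| / D,
    zeta_v = |Z^T u| / D, alpha = |mu| / D, gamma = |R^T (u - r)| / D are
    feasible in the program that defines delta: firm nonexpansiveness of the
    projection gives |r| <= |u| and |p|^2 + |mu|^2 <= |u|^2, and a component
    of mu outside the active set of y^* forces |p| >= Delta y^*_min. The rate
    is below 1 because |M_Z| < 1 and alpha^max < 1. *)

(** * Inner product, Euclidean norm and spectral norm *)

Section EuclideanSpace.
Variable K : realType.

Lemma vdotE n (x y : 'cV[K]_n) : vdot x y = \sum_i x i 0 * y i 0.
Proof. by rewrite /vdot mxE; apply: eq_bigr => i _; rewrite mxE. Qed.

Lemma vdotC n (x y : 'cV[K]_n) : vdot x y = vdot y x.
Proof. by rewrite !vdotE; apply: eq_bigr => i _; rewrite mulrC. Qed.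

Lemma vdotDr n (x y z : 'cV[K]_n) : vdot x (y + z) = vdot x y + vdot x z.
Proof. by rewrite /vdot mulmxDr mxE. Qed.

Lemma vdotZr n a (x y : 'cV[K]_n) : vdot x (a *: y) = a * vdot x y.
Proof. by rewrite /vdot -scalemxAr mxE. Qed.

Lemma vdotNr n (x y : 'cV[K]_n) : vdot x (- y) = - vdot x y.
Proof. by rewrite -scaleN1r vdotZr mulN1r. Qed.

Lemma vdotDl n (x y z : 'cV[K]_n) : vdot (y + z) x = vdot y x + vdot z x.
Proof. by rewrite vdotC vdotDr !(vdotC x). Qed.

Lemma vdotZl n a (x y : 'cV[K]_n) : vdot (a *: y) x = a * vdot y x.
Proof. by rewrite vdotC vdotZr vdotC. Qed.

Lemma vdotNl n (x y : 'cV[K]_n) : vdot (- y) x = - vdot y x.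
Proof. by rewrite vdotC vdotNr vdotC. Qed.

Lemma vdot0l n (x : 'cV[K]_n) : vdot 0 x = 0.
Proof. by rewrite -(scale0r 0) vdotZl mul0r. Qed.

Definition vdot_lin := (vdotDl, vdotDr, vdotNl, vdotNr, vdotZl, vdotZr).

Lemma vdot_mulmxl p n (B : 'M[K]_(p, n)) x y :
  vdot (B *m x) y = vdot x (B^T *m y).
Proof. by rewrite /vdot trmx_mul mulmxA. Qed.

Lemma vdot_ge0 n (x : 'cV[K]_n) : 0 <= vdot x x.
Proof. by rewrite vdotE sumr_ge0 // => i _; rewrite -expr2 sqr_ge0. Qed.

Lemma vdot_eq0 n (x : 'cV[K]_n) : (vdot x x == 0) = (x == 0).
Proof.
apply/idP/eqP => [|->]; last by rewrite vdot0l.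
rewrite vdotE psumr_eq0 => [/allP h|i _]; last by rewrite -expr2 sqr_ge0.
apply/matrixP => i j; rewrite ord1 mxE.
by apply/eqP; have := h i (mem_index_enum _); rewrite /= mulf_eq0 orbb.
Qed.

Lemma vdot_gt0 n (x : 'cV[K]_n) : (0 < vdot x x) = (x != 0).
Proof. by rewrite lt0r vdot_eq0 vdot_ge0 andbT. Qed.

Lemma coord_sqr_le_vdot n (x : 'cV[K]_n) i : x i 0 ^+ 2 <= vdot x x.
Proof.
rewrite vdotE (bigD1 i) //= -expr2 lerDl sumr_ge0 // => j _.
by rewrite -expr2 sqr_ge0.
Qed.

Lemma l2norm_ge0 n (x : 'cV[K]_n) : 0 <= l2norm x.
Proof. exact: sqrtr_ge0. Qed.

Lemma l2norm0 n : l2norm (0 : 'cV[K]_n) = 0.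
Proof. by rewrite /l2norm vdot0l sqrtr0. Qed.

Lemma sqr_l2norm n (x : 'cV[K]_n) : l2norm x ^+ 2 = vdot x x.
Proof. by rewrite sqr_sqrtr ?vdot_ge0. Qed.

Lemma l2norm_gt0 n (x : 'cV[K]_n) : (0 < l2norm x) = (x != 0).
Proof. by rewrite sqrtr_gt0 vdot_gt0. Qed.

Lemma l2normZ n a (x : 'cV[K]_n) : l2norm (a *: x) = `|a| * l2norm x.
Proof.
by rewrite /l2norm vdotZl vdotZr mulrA -expr2 sqrtrM ?sqr_ge0 // sqrtr_sqr.
Qed.

Lemma l2norm_le n p (x : 'cV[K]_n) (y : 'cV[K]_p) :
  (l2norm x <= l2norm y) = (vdot x x <= vdot y y).
Proof. by rewrite ler_sqrt ?vdot_ge0. Qed.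

(** The quadratic t |-> <x + t y, H (x + t y)> is nonnegative. The form [H] is kept general because
    both the identity and a positive definite matrix are used below. *)
Lemma psd_cauchy_schwarz n (H : 'M[K]_n) (x y : 'cV[K]_n) : psd H ->
  vdot x (H *m y) ^+ 2 <= vdot x (H *m x) * vdot y (H *m y).
Proof.
move=> [symH posH].
have quad t : 0 <= vdot x (H *m x) + 2 * t * vdot x (H *m y)
                   + t ^+ 2 * vdot y (H *m y).
  have := posH (x + t *: y); rewrite mulmxDr -scalemxAr !vdot_lin.
  have -> : vdot y (H *m x) = vdot x (H *m y).
    by rewrite [RHS]vdotC vdot_mulmxl symH.
  by congr (0 <= _); ring.
have c0 := posH y.
have [c1|c1] := eqVneq (vdot y (H *m y)) 0; last first.
  have cpos : 0 < vdot y (H *m y) by rewrite lt0r c1.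
  (* The minimiser of the quadratic. *)
  have := quad (- vdot x (H *m y) / vdot y (H *m y)).
  rewrite -(pmulr_lge0 _ cpos) -[_ ^+ 2 <= _]subr_ge0.
  by congr (0 <= _); field.
have [b1|b1] := eqVneq (vdot x (H *m y)) 0; first by rewrite b1 c1 expr0n mulr0.
(* By [c1] the quadratic is affine in t, and this t gives it the value -1. *)
have := quad (- (vdot x (H *m x) + 1) / (2 * vdot x (H *m y))).
suff -> : vdot x (H *m x) + 2 * (- (vdot x (H *m x) + 1) / (2 * vdot x (H *m y)))
   * vdot x (H *m y) + (- (vdot x (H *m x) + 1) / (2 * vdot x (H *m y))) ^+ 2
   * vdot y (H *m y) = -1 by lra.
by rewrite c1; field.
Qed.

Lemma psd1 n : psd (1%:M : 'M[K]_n).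
Proof. by split=> [|x]; rewrite ?trmx1 // mul1mx vdot_ge0. Qed.

Lemma vdot_le_l2norm n (x y : 'cV[K]_n) : vdot x y <= l2norm x * l2norm y.
Proof.
have := psd_cauchy_schwarz x y (psd1 n); rewrite !mul1mx -!sqr_l2norm -exprMn.
rewrite -ler_sqrt ?sqr_ge0 // !sqrtr_sqr [`|l2norm _ * _|]ger0_norm.
  exact/le_trans/ler_norm.
by rewrite mulr_ge0 ?l2norm_ge0.
Qed.

Lemma l2normD n (x y : 'cV[K]_n) : l2norm (x + y) <= l2norm x + l2norm y.
Proof.
rewrite -(@ler_pXn2r _ 2) ?nnegrE ?addr_ge0 ?l2norm_ge0 //.
rewrite sqr_l2norm !vdot_lin (vdotC y x) sqrrD !sqr_l2norm.
by have := vdot_le_l2norm x y; lra.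
Qed.

Lemma l2normN n (x : 'cV[K]_n) : l2norm (- x) = l2norm x.
Proof. by rewrite /l2norm vdotNl vdotNr opprK. Qed.

Lemma l2normB n (x y : 'cV[K]_n) : l2norm (x - y) <= l2norm x + l2norm y.
Proof. by rewrite -(l2normN y) l2normD. Qed.

(** The constant is the Frobenius norm, by Cauchy-Schwarz on each row. It makes the set in
    [spectral_norm] bounded, so that its [sup] is a genuine supremum. *)
Lemma l2norm_mulmx_bounded p n (B : 'M[K]_(p, n)) : exists2 C, 0 <= C &
  forall x, l2norm (B *m x) <= C * l2norm x.
Proof.
exists (Num.sqrt (\sum_i vdot (row i B)^T (row i B)^T)); first exact: sqrtr_ge0.
move=> x; have nB : 0 <= \sum_i vdot (row i B)^T (row i B)^T.
  by apply: sumr_ge0 => i _; exact: vdot_ge0.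
rewrite /l2norm -sqrtrM // ler_sqrt ?mulr_ge0 ?vdot_ge0 //.
rewrite [leLHS]vdotE mulr_suml ler_sum // => i _; rewrite -expr2.
have -> : (B *m x) i 0 = vdot (row i B)^T x.
  by rewrite mxE vdotE; apply: eq_bigr => j _; rewrite !mxE.
by have := psd_cauchy_schwarz (row i B)^T x (psd1 n); rewrite !mul1mx.
Qed.

Lemma spectral_norm_has_sup p n (B : 'M[K]_(p, n)) :
  has_sup [set l2norm (B *m x) | x in [set x : 'cV[K]_n | l2norm x <= 1]].
Proof.
have [C C0 hC] := l2norm_mulmx_bounded B; split.
  by exists (l2norm (B *m 0)), 0 => //=; rewrite l2norm0 ler01.
by exists C => _ [x /= x1 <-]; rewrite (le_trans (hC x)) // ler_piMr.
Qed.

Lemma spectral_norm_ge0 p n (B : 'M[K]_(p, n)) : 0 <= spectral_norm B.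
Proof.
apply: (ub_le_sup (spectral_norm_has_sup B).2); exists 0.
  by rewrite /= l2norm0 ler01.
by rewrite mulmx0 l2norm0.
Qed.

Lemma spectral_normP p n (B : 'M[K]_(p, n)) x :
  l2norm (B *m x) <= spectral_norm B * l2norm x.
Proof.
have [->|x0] := eqVneq x 0; first by rewrite mulmx0 !l2norm0 mulr0.
have nx : 0 < l2norm x by rewrite l2norm_gt0.
rewrite -ler_pdivrMr //; apply: (ub_le_sup (spectral_norm_has_sup B).2).
exists ((l2norm x)^-1 *: x); last first.
  by rewrite -scalemxAr l2normZ ger0_norm ?invr_ge0 ?l2norm_ge0 // mulrC.
by rewrite /= l2normZ ger0_norm ?invr_ge0 ?l2norm_ge0 // mulVf ?gt_eqF.
Qed.

Lemma spectral_norm_le p n (B : 'M[K]_(p, n)) C : 0 <= C ->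
  (forall x, l2norm (B *m x) <= C * l2norm x) -> spectral_norm B <= C.
Proof.
move=> C0 hC; apply: ge_sup => [|_ [x /= x1 <-]].
  exact: (spectral_norm_has_sup B).1.
by rewrite (le_trans (hC x)) // ler_piMr.
Qed.

Lemma l2norm_isometry p n (B : 'M[K]_(p, n)) x : B^T *m B = 1%:M ->
  l2norm (B *m x) = l2norm x.
Proof. by move=> hB; rewrite /l2norm vdot_mulmxl mulmxA hB mul1mx. Qed.

Lemma trmx_unit_columnsK n (S : {set 'I_n}) :
  (unit_columns K S)^T *m unit_columns K S = 1%:M.
Proof.
apply/matrixP => i j; rewrite !mxE (bigD1 (enum_val i)) //= big1 => [|k ki].
  by rewrite !mxE eqxx mul1r addr0 (inj_eq enum_val_inj).
by rewrite !mxE (negPf ki) mul0r.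
Qed.

(** E E^T is the coordinate projection onto S. Through it the support of a vector brings in the norm
    of R^T E. *)
Lemma unit_columns_trmxK n (S : {set 'I_n}) (x : 'cV[K]_n) :
  (forall i, i \notin S -> x i 0 = 0) ->
  unit_columns K S *m ((unit_columns K S)^T *m x) = x.
Proof.
move=> hx; have xE j : ((unit_columns K S)^T *m x) j 0 = x (enum_val j) 0.
  rewrite mxE (bigD1 (enum_val j)) //= big1 => [|k kj].
    by rewrite !mxE eqxx mul1r addr0.
  by rewrite !mxE (negPf kj) mul0r.
apply/matrixP => i k; rewrite ord1 mxE.
have [iS|iS] := boolP (i \in S); last first.
  rewrite hx // big1 // => j _; rewrite !mxE.
  case: eqP => [ij|_]; last by rewrite mul0r.
  by rewrite ij enum_valP in iS.
rewrite (bigD1 (enum_rank_in iS i)) //= big1 => [|j ji].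
  by rewrite xE mxE enum_rankK_in // eqxx mul1r addr0.
rewrite mxE; case: eqP => [ij|_]; last by rewrite mul0r.
by case/eqP: ji; apply: enum_val_inj; rewrite enum_rankK_in.
Qed.

(** * Positive definite matrices and the Cayley transform *)

Lemma pd_psd n (H : 'M[K]_n) : pd H -> psd H.
Proof.
move=> [symH posH]; split=> // x.
by have [->|/posH/ltW//] := eqVneq x 0; rewrite vdot0l.
Qed.

(** A row x of the left kernel has x H = 0, so the form vanishes at x^T and x = 0. *)
Lemma pd_unitmx n (H : 'M[K]_n) : pd H -> H \in unitmx.
Proof.
move=> [symH posH]; rewrite -row_free_unit -kermx_eq0; apply/eqP.
apply/row_matrixP => i; rewrite row0; apply: trmx_inj; rewrite trmx0.
apply/eqP/negP => /negP/posH; rewrite -{2}symH -trmx_mul.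
have /sub_kermxP -> : (row i (kermx H) <= kermx H)%MS by exact: row_sub.
by rewrite trmx0 vdotC vdot0l ltxx.
Qed.

(* Cauchy-Schwarz for the form [H], applied to [z] and [H^-1 z] *)
Lemma pd_coercive n (H : 'M[K]_n) : pd H ->
  exists2 e, 0 < e & forall z, e * vdot z z <= vdot z (H *m z).
Proof.
move=> pdH; have uH := pd_unitmx pdH; have [C C0 hC] := l2norm_mulmx_bounded (invmx H).
have C1 : 0 < C + 1 by lra.
exists (C + 1)^-1 => [|z]; first by rewrite invr_gt0.
have [->|z0] := eqVneq z 0; first by rewrite !vdot0l mulr0.
have zz : 0 < vdot z z by rewrite vdot_gt0.
rewrite mulrC ler_pdivrMr // -(ler_pM2r zz).
have := psd_cauchy_schwarz z (invmx H *m z) (pd_psd pdH).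
rewrite mulmxA mulmxV // mul1mx -expr2 => /le_trans; apply.
rewrite -mulrA ler_wpM2l ?(pd_psd pdH).2 // vdotC (le_trans (vdot_le_l2norm _ _)) //.
rewrite -sqr_l2norm expr2 mulrCA ler_wpM2l ?l2norm_ge0 // (le_trans (hC z)) //.
by rewrite ler_wpM2r ?l2norm_ge0 //; lra.
Qed.

(* With x = z + H z the Cayley transform maps x to z - H z, and
   |x|^2 - |z - H z|^2 = 4 <z, H z>. *)
Lemma cayley_spectral_norm_lt1 n (H : 'M[K]_n) : pd H ->
  H + 1%:M \in unitmx /\
  spectral_norm (2%:R *: invmx (H + 1%:M) - 1%:M) < 1.
Proof.
move=> pdH; have [symH posH] := pdH.
have uG : H + 1%:M \in unitmx.
  apply: pd_unitmx; split=> [|x x0]; first by rewrite linearD /= trmx1 symH.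
  by rewrite mulmxDl mul1mx vdotDr addr_gt0 ?posH ?vdot_gt0.
split=> //; have [e e0 he] := pd_coercive pdH.
have [C C0 hC] := l2norm_mulmx_bounded (H + 1%:M).
(* Since |x| <= C |z|, this t satisfies t |x|^2 <= 4 e |z|^2 <= 4 <z, H z>, a gap uniform in x. The
   denominator exceeds 4 e, so 0 < t < 1. *)
pose t := 4%:R * e / (C ^+ 2 + 4%:R * e + 1).
have D0 : 0 < C ^+ 2 + 4%:R * e + 1 by have := sqr_ge0 C; lra.
have t0 : 0 < t by rewrite divr_gt0 // mulr_gt0.
have t1 : t < 1 by rewrite ltr_pdivrMr //; have := sqr_ge0 C; lra.
apply: (@le_lt_trans _ _ (Num.sqrt (1 - t))); last first.
  by rewrite -[ltRHS]sqrtr1 ltr_sqrt ?ltr01 //; lra.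
apply: spectral_norm_le => [|x]; first exact: sqrtr_ge0.
pose z := invmx (H + 1%:M) *m x.
have xE : x = H *m z + z.
  by rewrite -{2}[z]mul1mx -mulmxDl mulmxA mulmxV // mul1mx.
have -> : (2%:R *: invmx (H + 1%:M) - 1%:M) *m x = z - H *m z.
  rewrite mulmxBl mul1mx -scalemxAl -/z {1}xE scaler_nat mulr2n.
  by rewrite opprD addrACA subrr addr0.
rewrite /l2norm -sqrtrM ?ler_sqrt ?mulr_ge0 ?vdot_ge0 //; try lra.
have xx : vdot x x <= (C ^+ 2 + 4%:R * e + 1) * vdot z z.
  have := hC z; rewrite mulmxDl mul1mx -xE.
  rewrite -(@ler_pXn2r _ 2) ?nnegrE ?mulr_ge0 ?l2norm_ge0 //.
  rewrite exprMn !sqr_l2norm => /le_trans; apply.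
  by rewrite ler_wpM2r ?vdot_ge0 //; lra.
have tx : t * vdot x x <= 4%:R * e * vdot z z.
  rewrite /t mulrAC ler_pdivrMr // -[leRHS]mulrA [_ * (_ + _ + _)]mulrC.
  by rewrite ler_wpM2l //; lra.
have hz := he z.
have xxE : vdot x x = vdot (z - H *m z) (z - H *m z) + 4%:R * vdot z (H *m z).
  by rewrite {1 2}xE !vdot_lin (vdotC (H *m z) z); ring.
by rewrite mulrBl mul1r; lra.
Qed.

End EuclideanSpace.

(** * The program that defines the contraction factor *)

Section ContractionFactor.
Variable K : realType.

(* With s = zeta_u, t = zeta_v the objective S satisfies both
   S <= 4 - (1 - kappa) s^2 - (s - t)^2 and S <= 8 s^2 + 2 (s - t)^2 + 4 amax^2;
   the bound below is the combination of the two with weights L and 1, where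
   L = 8 / (1 - kappa) + 2. *)
Lemma delta_feasible_bound (kappa c amax zu zv a g L : K) :
  0 <= kappa < 1 -> 0 <= c <= 1 -> delta_feasible c amax zu zv a g ->
  L = 8%:R / (1 - kappa) + 2%:R ->
  4%:R^-1 * ((kappa * zu + zv) ^+ 2 + g ^+ 2) <= (L + amax ^+ 2) / (L + 1).
Proof.
move=> /andP[k0 k1] /andP[c0 c1] [_ hg1 hg2 [/andP[s0 s1] /andP[t0 t1]]
  /andP[a0 a1]] LE.
have d0 : 0 < 1 - kappa by lra.
have Ld : L * (1 - kappa) = 8%:R + 2%:R * (1 - kappa).
  by rewrite LE mulrDl divfK // gt_eqF.
have L0 : 2%:R <= L by rewrite LE lerDr divr_ge0 // ltW.
have sqle (x : K) : 0 <= x -> x <= 1 -> x ^+ 2 <= 1.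
  by move=> x0 x1; rewrite -(expr1n _ 2) lerXn2r // nnegrE.
have s21 := sqle _ s0 s1; have t21 := sqle _ t0 t1; have c21 := sqle _ c0 c1.
have X2 : Num.sqrt (1 - zu ^+ 2) ^+ 2 = 1 - zu ^+ 2 by rewrite sqr_sqrtr //; lra.
have Y2 : Num.sqrt (1 - zv ^+ 2) ^+ 2 = 1 - zv ^+ 2 by rewrite sqr_sqrtr //; lra.
have ga : g ^+ 2 <= 4%:R * amax ^+ 2.
  apply: (le_trans hg1); rewrite -mulrA ler_pM2l ?ltr0n //.
  apply: (@le_trans _ _ (a ^+ 2)).
    by rewrite -[leRHS]mul1r ler_wpM2r ?sqr_ge0.
  by rewrite lerXn2r // nnegrE // (le_trans a0).
move: (Num.sqrt _) (Num.sqrt (1 - zv ^+ 2)) X2 Y2 hg2 => X Y X2 Y2 hg2.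
have ks : (kappa * zu + zv) ^+ 2 <= (zu + zv) ^+ 2 - (1 - kappa) * zu ^+ 2.
  rewrite -subr_ge0.
  have -> : (zu + zv) ^+ 2 - (1 - kappa) * zu ^+ 2 - (kappa * zu + zv) ^+ 2
     = (1 - kappa) * (zu * (kappa * zu + 2%:R * zv)) by ring.
  by rewrite mulr_ge0 ?(ltW d0) // mulr_ge0 // addr_ge0 ?mulr_ge0.
set S := _ + _.
(* The parallelogram identities give (zu + zv)^2 + (X + Y)^2 = 4 - (zu - zv)^2 - (X - Y)^2. *)
have S1 : S <= 4%:R - (1 - kappa) * zu ^+ 2 - (zu - zv) ^+ 2.
  by have := sqr_ge0 (X - Y); rewrite /S; lra.
(* Here 8 zu^2 + 2 (zu - zv)^2 - (zu + zv)^2 = (3 zu - zv)^2. *)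
have S2 : S <= 8%:R * zu ^+ 2 + 2%:R * (zu - zv) ^+ 2 + 4%:R * amax ^+ 2.
  have := sqr_ge0 (3%:R * zu - zv).
  have : 0 <= (1 - kappa) * zu ^+ 2 by rewrite mulr_ge0 ?sqr_ge0 // ltW.
  by rewrite /S; lra.
rewrite ler_pdivlMr; last by lra.
(* As L (1 - kappa) >= 8 and L >= 2, adding [S2] cancels the terms in zu and zv, leaving (L + 1) S
   <= 4 (L + amax^2). *)
have : L * S <= L * (4%:R - (1 - kappa) * zu ^+ 2 - (zu - zv) ^+ 2).
  by rewrite ler_wpM2l //; lra.
rewrite !mulrBr mulrA Ld.
have : 2%:R * (zu - zv) ^+ 2 <= L * (zu - zv) ^+ 2.
  by rewrite ler_wpM2r ?sqr_ge0.
have : 0 <= (1 - kappa) * zu ^+ 2 by rewrite mulr_ge0 ?sqr_ge0 // ltW.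
by lra.
Qed.

(** The origin is feasible and the uniform bound applies, so the [sup] in [delta] is a genuine
    supremum. *)
Lemma delta_has_sup (kappa c amax : K) :
  0 <= kappa < 1 -> 0 <= c <= 1 -> 0 <= amax ->
  has_sup [set t | exists zu zv a g : K, delta_feasible c amax zu zv a g /\
                   t = 4%:R^-1 * ((kappa * zu + zv) ^+ 2 + g ^+ 2)].
Proof.
move=> hk hc ha; split.
  exists 0, 0, 0, 0, 0; split; last by ring.
  split; rewrite ?lexx ?ler01 //; first by rewrite !expr0n /=; lra.
    by rewrite !expr0n /= mulr0.
  by rewrite [leLHS]expr0n /= sqr_ge0.
exists ((8%:R / (1 - kappa) + 2%:R + amax ^+ 2) / (8%:R / (1 - kappa) + 2%:R + 1)).
by move=> _ [zu [zv [a [g [hf ->]]]]]; exact: delta_feasible_bound hf _.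
Qed.

Lemma le_delta (kappa c amax zu zv a g : K) :
  0 <= kappa < 1 -> 0 <= c <= 1 -> 0 <= amax -> delta_feasible c amax zu zv a g ->
  4%:R^-1 * ((kappa * zu + zv) ^+ 2 + g ^+ 2) <= delta kappa c amax ^+ 2.
Proof.
move=> hk hc ha hf; rewrite /delta.
have [_ hub] := delta_has_sup hk hc ha.
(* Squaring undoes the root only if the supremum is nonnegative, which any objective value shows. *)
rewrite sqr_sqrtr.
  by apply: ub_le_sup => //; exists zu, zv, a, g.
apply: le_trans (_ : 4%:R^-1 * ((kappa * zu + zv) ^+ 2 + g ^+ 2) <= _).
  by rewrite mulr_ge0 ?invr_ge0 // addr_ge0 ?sqr_ge0.
by apply: ub_le_sup => //; exists zu, zv, a, g.
Qed.

(** The bound (L + amax^2) / (L + 1) is below 1 and uniform over the feasible set, so strictness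
    survives the supremum. *)
Lemma delta_lt1 (kappa c amax : K) :
  0 <= kappa < 1 -> 0 <= c <= 1 -> 0 <= amax < 1 -> delta kappa c amax < 1.
Proof.
move=> hk hc /andP[a0 a1]; have /andP[k0 k1] := hk.
rewrite /delta -[ltRHS]sqrtr1 ltr_sqrt ?ltr01 //.
apply: (@le_lt_trans _ _ ((8%:R / (1 - kappa) + 2%:R + amax ^+ 2)
                         / (8%:R / (1 - kappa) + 2%:R + 1))).
  apply: ge_sup; first exact: (delta_has_sup hk hc a0).1.
  by move=> _ [zu [zv [a [g [hf ->]]]]]; exact: delta_feasible_bound hf _.
have L0 : 0 <= 8%:R / (1 - kappa) by rewrite divr_ge0 //; lra.
rewrite ltr_pdivrMr ?mul1r ?ltrD2l; last by lra.
by rewrite -(expr1n _ 2) ltrXn2r // nnegrE.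
Qed.

End ContractionFactor.

(** * Projection onto the box and active bounds *)

Section Box.
Variable K : realType.
Implicit Types l u : \bar K.

(** For l < u, [fine] only meets finite bounds: x < l excludes l = -oo, l < u excludes l = +oo, and
    symmetrically for u. *)
Definition clamp l u (x : K) : K :=
  if (x%:E < l)%E then fine l else if (u < x%:E)%E then fine u else x.

Lemma clamp_in l u x : (l < u)%E -> (l <= (clamp l u x)%:E <= u)%E.
Proof.
rewrite /clamp; move: l u => [l| |] [u| |] //=;
  rewrite ?lte_fin ?ltNyr ?ltry ?leNye ?leey ?lee_fin //= => lu;
  repeat case: ltP => ?; rewrite ?lee_fin ?leNye ?leey //=; lra.
Qed.

Lemma clamp_obtuse l u x y : (l < u)%E -> (l <= y%:E <= u)%E ->
  (x - clamp l u x) * (y - clamp l u x) <= 0.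
Proof.
move=> lu /andP[ly yu]; rewrite /clamp.
case: ltP => [xl|lx].
  have lfin : l \is a fin_num.
    by move: l lu ly xl => [r| |].
  rewrite -(fineK lfin) ?lte_fin ?lee_fin in xl ly.
  by rewrite mulr_le0_ge0 ?subr_le0 ?subr_ge0 // ltW.
case: ltP => [ux|xu]; last by rewrite subrr mul0r.
have ufin : u \is a fin_num by move: u lu yu ux => [r| |] //; rewrite ?ltNye.
rewrite -(fineK ufin) ?lte_fin ?lee_fin in ux yu.
by rewrite mulr_ge0_le0 ?subr_le0 ?subr_ge0 // ltW.
Qed.

Lemma clamp_neq l u x : clamp l u x != x ->
  (clamp l u x = fine l /\ (x%:E < l)%E) \/ (clamp l u x = fine u /\ (u < x%:E)%E).
Proof.
rewrite /clamp; case: ifP => [|_]; first by left.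
by case: ifP => [|_]; [right | rewrite eqxx].
Qed.

(** The obtuse angle at the clamped point p gives |x - p|^2 + |y - p|^2 <= |x - y|^2 on the box, so
    p is the unique nearest point and [xget] must return it. *)
Lemma proj_box n (l u : 'I_n -> \bar K) (x : 'cV[K]_n) :
  (forall i, l i < u i)%E ->
  proj (box l u) x = \col_i clamp (l i) (u i) (x i 0).
Proof.
move=> lu; set p := \col_i _.
have pY : box l u p by move=> i; rewrite mxE clamp_in.
have hp y : box l u y ->
    vdot (x - p) (x - p) + vdot (y - p) (y - p) <= vdot (x - y) (x - y).
  move=> yY; have : vdot (x - p) (y - p) <= 0.
    rewrite vdotE sumr_le0 // => i _; rewrite !mxE.
    exact: clamp_obtuse.
  have -> : x - y = (x - p) - (y - p) by rewrite opprB addrA subrK.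
  rewrite -/(x - p); move: (x - p) (y - p) => s t.
  by rewrite !vdot_lin (vdotC t s); lra.
rewrite /proj; case: xgetP => [z _ [zY /(_ p pY)]|/(_ p)[]]; last first.
  split=> // y /hp h; rewrite l2norm_le (le_trans _ h) // lerDl.
  exact: vdot_ge0.
rewrite l2norm_le => hz; apply/eqP; rewrite -subr_eq0 -vdot_eq0 eq_le vdot_ge0.
by have := hp z zY; rewrite andbT; lra.
Qed.

Lemma box_proj n (l u : 'I_n -> \bar K) x :
  (forall i, l i < u i)%E -> box l u (proj (box l u) x).
Proof. by move=> lu i; rewrite proj_box // mxE clamp_in. Qed.

Lemma proj_box_obtuse n (l u : 'I_n -> \bar K) x y :
  (forall i, l i < u i)%E -> box l u y ->
  vdot (x - proj (box l u) x) (y - proj (box l u) x) <= 0.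
Proof.
move=> lu yY; rewrite proj_box // vdotE sumr_le0 // => i _; rewrite !mxE.
exact: clamp_obtuse.
Qed.

Lemma dy_star_gt0 n (l u : 'I_n -> \bar K) y i :
  box l u y -> i \notin active_star l u y -> (0 < dy_star l u y i)%E.
Proof.
move=> /(_ i)/andP[ly yu]; rewrite inE negb_or => /andP[nl nu].
by rewrite lt_min !sube_gt0 !lt_def nl ly yu andbT /= eq_sym nu.
Qed.

Lemma dy_star_min_gt0 n (l u : 'I_n -> \bar K) y :
  box l u y -> (0 < dy_star_min l u y)%E.
Proof.
move=> yY; rewrite /dy_star_min; elim/big_ind: _ => //.
  by move=> a b a0 b0; rewrite lt_min a0.
by move=> i iA; exact: dy_star_gt0.
Qed.

Lemma dy_star_min_le n (l u : 'I_n -> \bar K) y i :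
  i \notin active_star l u y -> (dy_star_min l u y <= dy_star l u y i)%E.
Proof. by move=> iA; rewrite /dy_star_min; exact: bigmin_le_cond. Qed.

(** An inactive coordinate can move both ways inside the box, so lam_i e >= 0 for some e of each
    sign. *)
Lemma multiplier_inactive n (l u : 'I_n -> \bar K) (lam y : 'cV[K]_n) i :
  perp_in (box l u) lam y -> i \notin active_star l u y -> lam i 0 = 0.
Proof.
move=> [yY hperp]; rewrite inE negb_or => /andP[nl nu].
have step e : (l i <= (y i 0 + e)%:E <= u i)%E -> 0 <= lam i 0 * e.
  move=> he; have := hperp (y + e *: delta_mx i 0); rewrite addrAC subrr add0r.
  rewrite vdotZr vdotE (bigD1 i) //= big1 => [|j ji]; last first.
    by rewrite mxE (negPf ji) mulr0.
  rewrite mxE !eqxx mulr1 addr0 mulrC; apply => j; rewrite !mxE.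
  have [->|_] := eqVneq j i; first by rewrite mulr1.
  by rewrite mulr0 addr0.
have /andP[ly yu] := yY i.
(* The step reaches the bound when it is finite and is 1 otherwise. *)
have [e1 e10 he1] : exists2 e, 0 < e & (l i <= (y i 0 - e)%:E)%E.
  move: nl ly; case: (l i) => [r| |] //.
    rewrite eqe lee_fin => ne le; exists (y i 0 - r); last by rewrite subKr.
    by rewrite subr_gt0 lt_def ne.
  by exists 1; rewrite ?leNye.
have [e2 e20 he2] : exists2 e, 0 < e & ((y i 0 + e)%:E <= u i)%E.
  move: nu yu; case: (u i) => [r| |] //.
    rewrite eqe lee_fin => ne le; exists (r - y i 0); last by rewrite addrC subrK.
    by rewrite subr_gt0 lt_def eq_sym ne.
  by exists 1; rewrite ?leey.
have yi2 : (u i >= (y i 0 - e1)%:E)%E.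
  by apply: le_trans yu; rewrite lee_fin; lra.
have yi1 : (l i <= (y i 0 + e2)%:E)%E.
  by apply: (le_trans ly); rewrite lee_fin; lra.
have := step (- e1); rewrite he1 yi2 => /(_ isT).
have := step e2; rewrite he2 yi1 => /(_ isT).
rewrite pmulr_lge0 // mulrN oppr_ge0 pmulr_lle0 // => h1 h2.
by apply/eqP; rewrite eq_le h1 h2.
Qed.

(** A coordinate moved by the projection lands on one of its bounds, and y_i is at least [dy_star]
    away from either. *)
Lemma proj_box_dist n (l u : 'I_n -> \bar K) (v y : 'cV[K]_n) i :
  (forall i, l i < u i)%E -> box l u y -> i \notin active_star l u y ->
  proj (box l u) v i 0 != v i 0 ->
  0 < fine (dy_star_min l u y) /\
  fine (dy_star_min l u y) <= `|proj (box l u) v i 0 - y i 0|.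
Proof.
move=> lu yY iA; rewrite proj_box // mxE => pv.
have d0 := dy_star_min_gt0 yY; have dle := dy_star_min_le iA.
(* Together with positivity, this inequality in the extended reals makes [dy_star_min] finite, so
   [fine] loses nothing. *)
suff h : (dy_star_min l u y <= (`|clamp (l i) (u i) (v i 0) - y i 0|)%:E)%E.
  have dfin : dy_star_min l u y \is a fin_num.
    rewrite fin_numE gt_eqF ?(lt_trans _ d0) ?ltNyr //=.
    by rewrite lt_eqF // (le_lt_trans h) ?ltry.
  by split; rewrite -?lee_fin -?lte_fin fineK.
apply: (le_trans dle); rewrite /dy_star ge_min.
have /andP[ly yu] := yY i.
have [[-> vl]|[-> uv]] := clamp_neq pv.
  have lfin : l i \is a fin_num.
    by move: (lu i) ly vl; case: (l i) => [r| |].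
  apply/orP; left; move: ly; rewrite -(fineK lfin) -EFinB !lee_fin /= => ly.
  by rewrite distrC ler_norm.
have ufin : u i \is a fin_num.
  by move: (lu i) yu uv; case: (u i) => [r| |] //; rewrite ?ltNye.
apply/orP; right; move: yu; rewrite -(fineK ufin) -EFinB !lee_fin /= => yu.
exact: ler_norm.
Qed.

End Box.

(** * Orthogonal splitting of the space by R and Z *)

Section Splitting.
Variables (K : realType) (m n : nat) (A : 'M[K]_(m, n)).
Variables (R : 'M[K]_(n, m)) (Z : 'M[K]_(n, n - m)).
Hypotheses (hA : row_free A) (hR : orthonormal_basis R A)
  (hZ : orthonormal_basis Z (kermx A^T)).

Lemma basis_AZ : A *m Z = 0.
Proof.
case: hZ => _ /andP[/sub_kermxP hZA _].
by rewrite -[A *m Z]trmxK trmx_mul hZA trmx0.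
Qed.

Lemma basis_ZA : Z^T *m A^T = 0.
Proof. by rewrite -trmx_mul basis_AZ trmx0. Qed.

Lemma basis_ZR : Z^T *m R = 0.
Proof.
case: hR => _ /andP[/submxP[D hD] _].
by rewrite -[R]trmxK hD trmx_mul mulmxA basis_ZA mul0mx.
Qed.

Lemma basis_RZ : R^T *m Z = 0.
Proof. by rewrite -[Z]trmxK -trmx_mul basis_ZR trmx0. Qed.

(** Stacking R^T on Z^T gives B with B B^T = 1. As m + (n - m) = n, B has full column rank, and its
    left inverse must be B^T. *)
Lemma basis_resolution : R *m R^T + Z *m Z^T = 1%:M.
Proof.
have [hRR _] := hR; have [hZZ _] := hZ.
(* Subtraction of naturals is truncated, so m + (n - m) = n rests on this. *)
have mn : (m <= n)%N by rewrite -(eqP hA) rank_leq_col.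
pose B := col_mx R^T Z^T.
have BBt : B *m B^T = 1%:M.
  rewrite /B tr_col_mx !trmxK mul_col_row hRR hZZ basis_RZ basis_ZR.
  by rewrite -scalar_mx_block.
have /row_fullP[C CB] : row_full B.
  have fB : row_free B by apply/row_freeP; exists B^T.
  by rewrite /row_full (eqP fB) subnKC.
have CE : C = B^T by rewrite -[C]mulmx1 -BBt mulmxA CB mul1mx.
by rewrite -CB CE /B tr_col_mx !trmxK mul_row_col.
Qed.

(** Since A Z = 0, A = (A R) R^T, so A R has rank at least that of A. *)
Lemma basis_AR_unit : A *m R \in unitmx.
Proof.
rewrite -row_free_unit /row_free eqn_leq rank_leq_row /= -{1}(eqP hA).
have {1}-> : A = A *m R *m R^T.
  by rewrite -{1}[A]mulmx1 -basis_resolution mulmxDr !mulmxA basis_AZ mul0mx addr0.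
exact: mxrankM_maxl.
Qed.

Lemma vdot_split (x : 'cV[K]_n) :
  vdot (R^T *m x) (R^T *m x) + vdot (Z^T *m x) (Z^T *m x) = vdot x x.
Proof.
by rewrite !vdot_mulmxl !trmxK !mulmxA -vdotDr -mulmxDl basis_resolution mul1mx.
Qed.

Lemma vdot_join (a : 'cV[K]_(n - m)) (g : 'cV[K]_m) :
  vdot (Z *m a + R *m g) (Z *m a + R *m g) = vdot a a + vdot g g.
Proof.
have [hRR _] := hR; have [hZZ _] := hZ.
rewrite -vdot_split !mulmxDr !mulmxA hRR hZZ basis_RZ basis_ZR !mul0mx.
by rewrite !mul1mx add0r addr0 addrC.
Qed.

Lemma spectral_norm_basis_columns_le1 (S : {set 'I_n}) :
  spectral_norm (R^T *m unit_columns K S) <= 1.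
Proof.
apply: spectral_norm_le => // x; rewrite mul1r -mulmxA.
rewrite -(l2norm_isometry x (trmx_unit_columnsK K S)) l2norm_le -[leRHS]vdot_split.
by rewrite lerDl vdot_ge0.
Qed.

(** * The operator M and one step of the iteration *)

Variables (Q : 'M[K]_n) (beta : K).
Hypotheses (hbeta : 0 < beta) (hZQZ : pd (Z^T *m Q *m Z)).

Lemma scaled_pd : pd (beta^-1 *: (Z^T *m Q *m Z)).
Proof.
case: hZQZ => sym pos; split=> [|x x0]; first by rewrite linearZ /= sym.
by rewrite -scalemxAl vdotZr mulr_gt0 ?invr_gt0 ?pos.
Qed.

(** M_Z is the Cayley transform of Z^T Q Z / beta. *)
Lemma MZ_norm_lt1 : spectral_norm (MZmat Q beta Z) < 1.
Proof. exact: (cayley_spectral_norm_lt1 scaled_pd).2. Qed.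

Lemma reduced_hessian :
  Z^T *m (beta^-1 *: Q + 1%:M) *m Z = beta^-1 *: (Z^T *m Q *m Z) + 1%:M.
Proof.
have [hZZ _] := hZ.
by rewrite mulmxDr mulmxDl mulmx1 hZZ -scalemxAr -scalemxAl.
Qed.

Lemma Mmat_MZ : 2%:R *: Mmat Q beta Z = Z *m MZmat Q beta Z *m Z^T + Z *m Z^T.
Proof.
rewrite /Mmat /MZmat reduced_hessian mulmxBr mulmxBl mulmx1 subrK.
by rewrite -scalemxAr -scalemxAl.
Qed.

Lemma Mmat_hessian (y : 'cV[K]_n) :
  Mmat Q beta Z *m ((beta^-1 *: Q + 1%:M) *m (Z *m (Z^T *m y))) = Z *m (Z^T *m y).
Proof.
have uG : Z^T *m (beta^-1 *: Q + 1%:M) *m Z \in unitmx.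
  by rewrite reduced_hessian (cayley_spectral_norm_lt1 scaled_pd).1.
by rewrite -[in RHS](mulKmx uG (Z^T *m y)) /Mmat !mulmxA.
Qed.

(** The optimality conditions turn the argument of M into (Q / beta + 1) [ystar] + A^T [xi] / beta,
    and M kills the last term because Z^T A^T = 0. *)
Lemma admm_fixpoint (q ystar lamstar : 'cV[K]_n) (b xi : 'cV[K]_m) :
  Q *m ystar + A^T *m xi - lamstar = - q -> A *m ystar = b ->
  Mmat Q beta Z *m (ystar + beta^-1 *: lamstar - beta^-1 *: q)
    + Nmat Q beta A R Z *m b = ystar.
Proof.
move=> kkt <-.
have MA x : Mmat Q beta Z *m (A^T *m x) = 0.
  by rewrite /Mmat -!mulmxA (mulmxA Z^T A^T) basis_ZA mul0mx !mulmx0.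
have MR x : Mmat Q beta Z *m (R *m x) = 0.
  by rewrite /Mmat -!mulmxA (mulmxA Z^T R) basis_ZR mul0mx !mulmx0.
have -> : ystar + beta^-1 *: lamstar - beta^-1 *: q
    = (beta^-1 *: Q + 1%:M) *m ystar + A^T *m (beta^-1 *: xi).
  have -> : q = - (Q *m ystar + A^T *m xi - lamstar) by rewrite kkt opprK.
  rewrite mulmxDl mul1mx -scalemxAl -scalemxAr.
  by apply/matrixP => i j; rewrite !mxE; ring.
have decomp x : x = R *m (R^T *m x) + Z *m (Z^T *m x).
  by rewrite !mulmxA -mulmxDl basis_resolution mul1mx.
(* The right-hand side b determines the R-part of [ystar]. *)
have RAR : R *m (invmx (A *m R) *m (A *m ystar)) = R *m (R^T *m ystar).
  rewrite {1}[ystar]decomp mulmxDr (mulmxA A Z) basis_AZ mul0mx addr0.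
  by rewrite (mulmxA A) mulKmx // basis_AR_unit.
move: MA MR (Mmat_hessian ystar); rewrite /Nmat.
move: (Mmat Q beta Z) => M MA MR hess.
rewrite mulmxDr MA addr0 -!mulmxA RAR mulmxBl mul1mx.
(* M reproduces the Z-part; on the R-part its contribution M Q / beta cancels the correction inside
   N. *)
rewrite {1}[ystar]decomp !mulmxDr hess mulmxDl mul1mx mulmxDr MR addr0.
by rewrite -mulmxA addrC subrKA -decomp.
Qed.

(** The factor 4 clears the halves: 2 M = Z M_Z Z^T + Z Z^T and 2 (u - p) = u - r. Splitting u - r
    along Z and R leaves two orthogonal terms. *)
Lemma vdot_step (u p : 'cV[K]_n) : let r := 2%:R *: p - u in
  4%:R * vdot (Mmat Q beta Z *m r + u - p) (Mmat Q beta Z *m r + u - p) =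
  vdot (MZmat Q beta Z *m (Z^T *m r) + Z^T *m u)
       (MZmat Q beta Z *m (Z^T *m r) + Z^T *m u)
  + vdot (R^T *m (u - r)) (R^T *m (u - r)).
Proof.
move=> r; rewrite -vdot_join.
have <- : 2%:R *: (Mmat Q beta Z *m r + u - p) =
  Z *m (MZmat Q beta Z *m (Z^T *m r) + Z^T *m u) + R *m (R^T *m (u - r)).
  have ur : 2%:R *: (u - p) = u - r by apply/matrixP => i j; rewrite !mxE; ring.
  rewrite -addrA scalerDr ur scalemxAl Mmat_MZ mulmxDl mulmxDr !mulmxA.
  have -> : R *m R^T = 1%:M - Z *m Z^T by rewrite -basis_resolution addrK.
  rewrite mulmxBl mul1mx [_ *m (u - r)]mulmxBr -!addrA; congr (_ + _).
  move: (_ *m r) (_ *m u) => s t.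
  by apply/matrixP => i j; rewrite !mxE; ring.
by rewrite vdotZl vdotZr; ring.
Qed.

(** The scaled norms form a feasible point of the program of [delta], whose objective there
    dominates the squared step by [vdot_step] and the triangle inequality. *)
Lemma step_contraction (u p : 'cV[K]_n) (S : {set 'I_n}) (amax : K) :
  u != 0 -> 0 <= vdot p (u - p) -> (forall i, i \notin S -> (p - u) i 0 = 0) ->
  0 <= amax -> vdot (p - u) (p - u) <= amax ^+ 2 * vdot u u ->
  l2norm (Mmat Q beta Z *m (2%:R *: p - u) + u - p) <=
  delta (spectral_norm (MZmat Q beta Z))
        (spectral_norm (R^T *m unit_columns K S)) amax * l2norm u.
Proof.
move=> u0 mono supp amax0 hamax.
set kappa := spectral_norm (MZmat _ _ _); set c := spectral_norm (R^T *m _).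
set r := 2%:R *: p - u; pose mu := p - u.
have D0 : 0 < l2norm u by rewrite l2norm_gt0.
have hk : 0 <= kappa < 1 by rewrite spectral_norm_ge0 MZ_norm_lt1.
have hc : 0 <= c <= 1 by rewrite spectral_norm_ge0 spectral_norm_basis_columns_le1.
(* |r|^2 = |u|^2 - 4 <p, u - p>. *)
have ru : vdot r r <= vdot u u.
  by move: mono; rewrite /r !vdot_lin (vdotC u p); lra.
have urE : u - r = - 2%:R *: mu.
  by apply/matrixP => i j; rewrite !mxE; ring.
(* As mu is supported on S, mu = E E^T mu and |E^T mu| = |mu|. *)
have Rmu : l2norm (R^T *m mu) <= c * l2norm mu.
  rewrite -{1}[mu](unit_columns_trmxK supp) mulmxA (le_trans (spectral_normP _ _)) //.
  rewrite ler_wpM2l ?(andP hc).1 //.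
  by rewrite -(l2norm_isometry _ (trmx_unit_columnsK K S)) unit_columns_trmxK.
have Rmu2 : vdot (R^T *m mu) (R^T *m mu) <= c ^+ 2 * vdot mu mu.
  rewrite -!sqr_l2norm -exprMn lerXn2r // nnegrE ?l2norm_ge0 //.
  by rewrite mulr_ge0 ?l2norm_ge0 ?(andP hc).1.
pose D := l2norm u; pose zu := l2norm (Z^T *m r) / D.
pose zv := l2norm (Z^T *m u) / D; pose g := l2norm (R^T *m (u - r)) / D.
have D2 : D ^+ 2 = vdot u u := sqr_l2norm u.
have D2pos : 0 < D ^+ 2 by rewrite exprn_gt0.
have sqd (d : nat) (x : 'cV[K]_d) : (l2norm x / D) ^+ 2 = vdot x x / D ^+ 2.
  by rewrite expr_div_n sqr_l2norm.
have scale (d : nat) (x : 'cV[K]_d) : 0 <= l2norm x / D.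
  by rewrite divr_ge0 ?l2norm_ge0.
have unit_le (x : 'cV[K]_n) : vdot x x <= vdot u u -> l2norm (Z^T *m x) / D <= 1.
  move=> xu; rewrite ler_pdivrMr // mul1r l2norm_le (le_trans _ xu) //.
  by rewrite -[leRHS]vdot_split lerDr vdot_ge0.
have R_le (x : 'cV[K]_n) : vdot x x <= vdot u u ->
    l2norm (R^T *m x) / D <= Num.sqrt (1 - (l2norm (Z^T *m x) / D) ^+ 2).
  move=> xu; rewrite -[leLHS]ger0_norm // -sqrtr_sqr.
  have Zle : (l2norm (Z^T *m x) / D) ^+ 2 <= 1.
    by rewrite -(expr1n _ 2) lerXn2r // ?nnegrE // unit_le.
  rewrite ler_wsqrtr // lerBrDr !sqd -mulrDl vdot_split.
  by rewrite ler_pdivrMr // mul1r D2.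
have feas : delta_feasible c amax zu zv (l2norm mu / D) g.
  split.
  (* [zu] + [zv] is at least |Z^T (r - u)| / D = 2 |Z^T mu| / D, and |Z^T mu|^2 = |mu|^2 - |R^T
     mu|^2 >= (1 - c^2) |mu|^2. *)
  - apply: (@le_trans _ _ ((l2norm (Z^T *m (r - u)) / D) ^+ 2)).
      rewrite !sqd -[r - u]opprB urE -scaleNr opprK -scalemxAr vdotZl vdotZr.
      rewrite [leLHS]mulrA ler_wpM2r ?invr_ge0 ?(ltW D2pos) //.
      by have := vdot_split mu; lra.
    rewrite lerXn2r // ?nnegrE ?addr_ge0 ?scale //.
    rewrite /zu /zv -mulrDl.
    rewrite ler_wpM2r ?invr_ge0 ?l2norm_ge0 //.
    by rewrite mulmxBr l2normB.
  - rewrite !sqd urE -scalemxAr vdotZl vdotZr.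
    rewrite [leRHS]mulrA ler_wpM2r ?invr_ge0 ?(ltW D2pos) //.
    by move: Rmu2; lra.
  - rewrite lerXn2r // ?nnegrE ?addr_ge0 ?sqrtr_ge0 ?scale //.
    rewrite addrC (le_trans _ (lerD (R_le u _) (R_le r ru))) ?lexx //.
    by rewrite -mulrDl ler_wpM2r ?invr_ge0 ?l2norm_ge0 // mulmxBr l2normB.
  - by rewrite !scale !unit_le.
  - rewrite scale /= -(@ler_pXn2r _ 2) ?nnegrE //.
    by rewrite sqd ler_pdivrMr // D2.
have := le_delta hk hc amax0 feas.
set rate := delta _ _ _ => hrate.
have rate0 : 0 <= rate by exact: sqrtr_ge0.
rewrite -(@ler_pXn2r _ 2) ?nnegrE ?mulr_ge0 ?l2norm_ge0 //.
rewrite sqr_l2norm exprMn -/D.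
apply: (le_trans _ (ler_wpM2r (ltW D2pos) hrate)).
rewrite -(ler_pM2l (ltr0n K 4)) vdot_step // -/r.
have -> : 4%:R * (4%:R^-1 * ((kappa * zu + zv) ^+ 2 + g ^+ 2) * D ^+ 2) =
   (kappa * (zu * D) + zv * D) ^+ 2 + (g * D) ^+ 2 by field.
rewrite !divfK ?gt_eqF // !sqr_l2norm lerD2r -sqr_l2norm.
rewrite lerXn2r ?nnegrE ?l2norm_ge0 //.
  by rewrite addr_ge0 ?mulr_ge0 ?l2norm_ge0 // (andP hk).1.
by rewrite (le_trans (l2normD _ _)) // lerD2r spectral_normP.
Qed.

End Splitting.

(** * Contraction along the iteration *)

Theorem theorem2 (K : realType) (m n : nat)
    (Q : 'M[K]_n) (q : 'cV[K]_n) (A : 'M[K]_(m, n)) (b : 'cV[K]_m)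
    (l u : 'I_n -> \bar K) (beta : K)
    (R : 'M[K]_(n, m)) (Z : 'M[K]_(n, n - m))
    (ystar lamstar : 'cV[K]_n) (y w lam : nat -> 'cV[K]_n)
    (hQ : psd Q)
    (hlu : forall i, (l i < u i)%E)
    (hbeta : 0 < beta)
    (hR : orthonormal_basis R A)
    (hZ : orthonormal_basis Z (kermx A^T))
    (hY : box l u !=set0)
    (hA : row_free A)
    (hZQZ : pd (Z^T *m Q *m Z))
    (hstar : optimal_with_multipliers Q q A b l u ystar lamstar)
    (hRE : \rank (row_mx R (unit_columns K (active_star l u ystar)))
           = (m + #|active_star l u ystar|)%N)
    (hadmm : admm Q q A b l u R Z beta y w lam)
    (k : nat)
    (hk : ~~ (active_iter beta lamstar lam k \subset active_star l u ystar)) :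
  let v := vseq y lam in
  let vs := vstar beta ystar lamstar in
  let Delta := l2norm (v k - vs) in
  let c := cF R beta lamstar lam k in
  let rate := delta (spectral_norm (MZmat Q beta Z)) c
                    (alpha_max l u ystar Delta) in
  [/\ l2norm (v k.+1 - vs) <= rate * Delta, rate < 1 & c <= 1].

Proof.
move=> v vs Delta c rate.
case: hstar => xi [kkt feas hperp]; have [ysY perp] := hperp.
have [_ wE lamE] := hadmm k; have [yE _ _] := hadmm k.+1.
rewrite -/(vseq y lam k) -/v in wE.
pose P := proj (box l u) (v k).
pose p := P - ystar; pose ub := v k - vs.
(* [v k] pairs y^(k+1) with lambda^k, so w^(k+1) is its projection and lambda^(k+1) the residual. *)
have lamP : lam k.+1 = P - v k.
  by rewrite lamE wE -/P /v /vseq opprB addrA [lam k + P]addrC addrAC.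
have muE : p - ub = lam k.+1 - beta^-1 *: lamstar.
  by rewrite lamP /p /ub /vs /vstar; apply/matrixP => i j; rewrite !mxE; ring.
(* The fixed-point identity for [ystar] is subtracted from the formula for y^(k+2); the constant
   terms cancel. *)
have step : v k.+1 - vs = Mmat Q beta Z *m (2%:R *: p - ub) + ub - p.
  rewrite {1}/v /vseq yE wE -/P /vs /vstar.
  rewrite -{1}(admm_fixpoint hA hR hZ hbeta hZQZ kkt feas).
  have -> : 2%:R *: p - ub = (P + lam k.+1 - beta^-1 *: q)
      - (ystar + beta^-1 *: lamstar - beta^-1 *: q).
    by rewrite lamP /p /ub /vs /vstar; apply/matrixP => i j; rewrite !mxE; ring.
  have -> : ub = p - (lam k.+1 - beta^-1 *: lamstar) by rewrite -muE subKr.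
  rewrite [Mmat _ _ _ *m (_ - (_ + _ - _))]mulmxBr.
  move: (Mmat _ _ _ *m _) (Mmat _ _ _ *m _) (Nmat _ _ _ _ _ *m _) => a d e.
  by apply/matrixP => i j; rewrite !mxE; ring.
(* [ub - p] is [lamstar] / beta + ([v k] - P): the multiplier inequality tested at P and the
   projection inequality tested at [ystar] add up. *)
have mono : 0 <= vdot p (ub - p).
  have -> : ub - p = beta^-1 *: lamstar + (v k - P).
    by rewrite -[v k - P]opprB -lamP -[ub - p]opprB muE opprB.
  have h1 : vdot (v k - P) (ystar - P) <= 0 := proj_box_obtuse (v k) hlu ysY.
  have h2 : 0 <= vdot lamstar p := perp P (box_proj (v k) hlu).
  rewrite -[ystar - P]opprB -/p vdotNr oppr_le0 in h1.
  rewrite vdotC vdotDl vdotZl addr_ge0 // mulr_ge0 // invr_ge0.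
  exact: ltW.
have pyth : vdot p p + vdot (p - ub) (p - ub) <= vdot ub ub.
  move: (p) (ub) mono => s t; rewrite !vdot_lin (vdotC t s); lra.
case/subsetPn: hk => i iA iAs.
(* The multiplier [lamstar] vanishes at the inactive index i, so lambda^(k+1) is nonzero there and
   the projection moves this coordinate. *)
have Pv : P i 0 != v k i 0.
  apply: contraTneq iA => Pi; rewrite inE negbK lamP.
  rewrite mxE [(- v k) i 0]mxE Pi subrr.
  by rewrite (multiplier_inactive hperp iAs) mul0r.
have [d0 dp] := proj_box_dist hlu ysY iAs Pv.
rewrite -/P in dp; set d := fine _ in d0 dp.
have d2 : d ^+ 2 <= vdot p p.
  apply: le_trans (coord_sqr_le_vdot p i).
  rewrite -[leRHS]real_normK ?num_real // lerXn2r ?nnegrE ?(ltW d0) //.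
  by rewrite !mxE.
have ub2 : 0 < vdot ub ub.
  have : 0 < d ^+ 2 by rewrite exprn_gt0.
  by have := vdot_ge0 (p - ub); lra.
have Delta2 : Delta ^+ 2 = vdot ub ub := sqr_l2norm _.
have amaxlt1 : 0 <= alpha_max l u ystar Delta < 1.
  rewrite sqrtr_ge0 -[ltRHS]sqrtr1 ltr_sqrt ?ltr01 //= ltrBlDr ltrDl.
  by rewrite exprn_gt0 // divr_gt0 // l2norm_gt0 -vdot_gt0.
split; last exact: spectral_norm_basis_columns_le1 hA hR hZ _.
- rewrite step; apply: (step_contraction hA hR hZ hbeta hZQZ).
  + by rewrite -vdot_gt0.
  + exact: mono.
  + by move=> j; rewrite muE inE negbK !mxE => /eqP->; rewrite mulrC subrr.
  + exact: sqrtr_ge0.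
  (* The radicand of [alpha_max] is nonnegative, so its square times |ub|^2 is |ub|^2 - d^2 >=
     |ub|^2 - |p|^2 >= |p - ub|^2. *)
  have X0 : d ^+ 2 / vdot ub ub <= 1.
    by rewrite ler_pdivrMr // mul1r; have := vdot_ge0 (p - ub); lra.
  rewrite /alpha_max -/d expr_div_n Delta2 sqr_sqrtr ?subr_ge0 //.
  by rewrite mulrBl mul1r divfK ?gt_eqF //; lra.
- apply: delta_lt1 => //; first by rewrite spectral_norm_ge0 (MZ_norm_lt1 hbeta).
  by rewrite spectral_norm_ge0 (spectral_norm_basis_columns_le1 hA hR hZ).
Qed.
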